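(* Let $F$ be a field, $\Lambda=M_s(F)$, $A,B,C,D\in\Lambda$. Let $a_1,a_2,\ldots\in F$ and suppose there is a polynomial function whose value at $j$ is $a_j$ for all sufficiently large $j$. Let $R_n=\sum_{k\ge1}a_ku_k^{(n)}$. Then all matrix entries of $\sum_{n\ge0}R_nz^n$ lie in $\mathcal{L}$.
   Context: A walk of length $l\ge0$ is an $(l+1)$-tuple $\alpha=(\alpha_0,\dots,\alpha_l)$ of integers with each $\alpha_i-\alpha_{i-1}\in\{-1,0,1\}$; it is a walk from $\alpha_0$ to $\alpha_l$. Weights: $w(\alpha)=1$ if $l=0$, else $w(\alpha)=U_1\cdots U_l$ with $U_i=A,B,C$ according as $\alpha_i-\alpha_{i-1}=-1,0,1$; $w^*(\alpha)$ is defined the same way except that $U_i=D$ whenever $\alpha_{i-1}=\alpha_i=0$. A walk is standard if $\alpha_i\ge\alpha_l$ for all $i$. For $k\ge1$, $u_k^{(n)}=\sum w^*(\alpha)$ over all standard walks of length $n$ from $k-1$ to $0$ (so $u_k^{(n)}=0$ when $k-1>n$ and $R_n$ is a finite sum). $M_0=\sum w(\alpha)z^{l(\alpha)}$ over all (not necessarily standard) walks from $0$ to $0$, $M_{-1}$ the same sum over walks from $-1$ to $0$, $M_1$ the same sum over walks from $1$ to $0$; these are $s\times s$ matrices over $F[[z]]$. $\mathcal{L}$ is the subfield of the field of fractions of $F[[z]]$ generated over $F(z)$ by the matrix entries of $M_0,M_1,M_{-1}$. *)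

(* Defs.v *)
From HB Require Import structures.
From mathcomp Require Import all_boot all_order all_algebra.
From mathcomp Require Import all_classical.
From mathcomp Require Import zify.

Set Implicit Arguments.
Unset Strict Implicit.
Unset Printing Implicit Defensive.

Import Order.TTheory GRing.Theory Num.Theory.
Local Open Scope classical_set_scope.
Local Open Scope ring_scope.

(* The ring F[[z]] of formal power series; [coefs f n] is the coefficient of
   z^n.  A record, and not a function type, so as not to inherit the pointwise
   product of functions. *)
Record fps (F : fieldType) := FPS { coefs : nat -> F }.

Section FPSRing.
Variable F : fieldType.
Implicit Types f g h : fps F.

Lemma fpsP f g : coefs f =1 coefs g <-> f = g.
Proof.
split=> [|-> //]; case: f g => [f] [g] /= fg.
by congr FPS; apply/funext.
Qed.

HB.instance Definition _ := gen_eqMixin (fps F).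
HB.instance Definition _ := gen_choiceMixin (fps F).

Definition fps_zero : fps F := FPS (fun=> 0).
Definition fps_opp f : fps F := FPS (fun n => - coefs f n).
Definition fps_add f g : fps F := FPS (fun n => coefs f n + coefs g n).
Definition fps_one : fps F := FPS (fun n => (n == 0%N)%:R).
Definition fps_mul f g : fps F :=
  FPS (fun n => \sum_(i < n.+1) coefs f i * coefs g (n - i)%N).

Fact fps_addA : associative fps_add.
Proof. by move=> f g h; apply/fpsP => n /=; rewrite addrA. Qed.
Fact fps_addC : commutative fps_add.
Proof. by move=> f g; apply/fpsP => n /=; rewrite addrC. Qed.
Fact fps_add0 : left_id fps_zero fps_add.
Proof. by move=> f; apply/fpsP => n /=; rewrite add0r. Qed.
Fact fps_addN : left_inverse fps_zero fps_opp fps_add.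
Proof. by move=> f; apply/fpsP => n /=; rewrite addNr. Qed.

HB.instance Definition _ :=
  GRing.isZmodule.Build (fps F) fps_addA fps_addC fps_add0 fps_addN.

Definition fps_trunc (N : nat) f : {poly F} := \poly_(i < N.+1) coefs f i.

Lemma coef_trunc N f i : (i <= N)%N -> (fps_trunc N f)`_i = coefs f i.
Proof. by move=> iN; rewrite coef_poly ltnS iN. Qed.

Lemma coef_trunc_mul N f g n : (n <= N)%N ->
  coefs (fps_mul f g) n = (fps_trunc N f * fps_trunc N g)`_n.
Proof.
move=> nN; rewrite coefM; apply: eq_bigr => i _.
by rewrite !coef_trunc //; have := ltn_ord i; lia.
Qed.

Fact fps_mulC : commutative fps_mul.
Proof.
by move=> f g; apply/fpsP => n; rewrite !(coef_trunc_mul _ _ (leqnn n)) mulrC.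
Qed.

Fact fps_mulA : associative fps_mul.
Proof.
move=> f g h; apply/fpsP => n.
transitivity (fps_trunc n f * fps_trunc n g * fps_trunc n h)`_n.
  rewrite -mulrA coefM /=; apply: eq_bigr => i _.
  rewrite coef_trunc; last by have := ltn_ord i; lia.
  by rewrite -coef_trunc_mul // leq_subr.
rewrite coefM /=; apply: eq_bigr => i _.
rewrite -coef_trunc_mul; last by have := ltn_ord i; lia.
by rewrite coef_trunc // leq_subr.
Qed.

Fact fps_mul1 : left_id fps_one fps_mul.
Proof.
move=> f; apply/fpsP => n /=; rewrite big_ord_recl /= mul1r subn0.
by rewrite big1 ?addr0 // => i _; rewrite mul0r.
Qed.

Fact fps_mulDl : left_distributive fps_mul fps_add.
Proof.
move=> f g h; apply/fpsP => n /=; rewrite -big_split /=.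
by apply: eq_bigr => i _; rewrite mulrDl.
Qed.

Fact fps_one_neq0 : fps_one != fps_zero.
Proof.
by apply/eqP => /fpsP/(_ 0%N) /= /eqP; rewrite oner_eq0.
Qed.

HB.instance Definition _ := GRing.Zmodule_isComNzRing.Build (fps F)
  fps_mulA fps_mulC fps_mul1 fps_mulDl fps_one_neq0.

Definition fps_unit : {pred fps F} := fun f => `[< exists g, g * f = 1 >].
Definition fps_inv f : fps F := xget f [set g | g * f = 1].

Fact fps_mulV : {in fps_unit, left_inverse 1 fps_inv *%R}.
Proof.
move=> f /asboolP [g gf]; rewrite /fps_inv.
by case: xgetP => [_ _ //|/(_ g)]; rewrite /= gf.
Qed.

Fact fps_unitP f g : g * f = 1 -> fps_unit f.
Proof. by move=> gf; apply/asboolP; exists g. Qed.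

Fact fps_inv_out : {in [predC fps_unit], fps_inv =1 id}.
Proof.
move=> f /asboolP fU; rewrite /fps_inv; case: xgetP => // g _ /= gf.
by case: fU; exists g.
Qed.

HB.instance Definition _ := GRing.ComNzRing_hasMulInverse.Build (fps F)
  fps_mulV fps_unitP fps_inv_out.

Lemma fps_order f : f != 0 ->
  exists2 n, coefs f n != 0 & forall i, (i < n)%N -> coefs f i = 0.
Proof.
move=> f0; have fn : exists n, coefs f n != 0.
  apply: contrapT => nf; move/eqP: f0; apply; apply/fpsP => n /=.
  by apply/eqP/negPn/negP => fn; apply: nf; exists n.
case: (ex_minnP fn) => n fn' nmin; exists n => // i; case: (eqVneq (coefs f i) 0) => //.
by move/nmin; rewrite leqNgt => /negbTE ->.
Qed.

Fact fps_idomain : GRing.integral_domain_axiom (fps F).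
Proof.
move=> f g fg; apply/norP => -[/fps_order[m fm fm0] /fps_order[n gn gn0]].
have /fpsP/(_ (m + n)%N) /= := fg => /eqP.
rewrite (bigD1 (inord m)) //= inordK ?ltnS ?leq_addr // addKn.
rewrite big1 ?addr0 ?mulf_eq0 ?(negbTE fm) ?(negbTE gn) // => i im.
have {}im : nat_of_ord i != m.
  apply: contraNneq im => im; apply/eqP/val_inj.
  by rewrite /= inordK ?ltnS ?leq_addr.
have [/fm0->|mi] := ltnP i m; first by rewrite mul0r.
by rewrite gn0 ?mulr0 //; have := ltn_ord i; lia.
Qed.

HB.instance Definition _ := GRing.ComUnitRing_isIntegral.Build (fps F)
  fps_idomain.

End FPSRing.

Definition fps_of_poly (F : fieldType) (p : {poly F}) : fps F :=
  FPS (fun i => p`_i).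

(* F(z), as a subfield of the field of fractions of F[[z]]. *)
Definition ratfun (F : fieldType) : set {fraction (fps F)} :=
  [set x | exists p q : {poly F},
     q != 0 /\ x = tofrac (fps_of_poly p) / tofrac (fps_of_poly q)].
Arguments ratfun : clear implicits.

Definition is_subfield (K : fieldType) (S : set K) : Prop :=
  GRing.divring_closed (mem S).

Definition generated_subfield (K : fieldType) (G : set K) : set K :=
  smallest (@is_subfield K) G.

(* The series \sum_n c_n z^n with matrix coefficients, as a matrix of series. *)
Definition mx_series (F : fieldType) (s : nat) (c : nat -> 'M[F]_s) :
  'M[fps F]_s := \matrix_(i, j) FPS (fun n => c n i j).

Definition frac_entries (F : fieldType) (s : nat) (M : 'M[fps F]_s) :
  set {fraction (fps F)} := [set x | exists i j, x = tofrac (M i j)].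

Definition is_walk (l : nat) (alpha : l.+1.-tuple int) : Prop :=
  forall i : 'I_l, alpha`_i.+1 - alpha`_i \in [:: -1; 0; 1].

Definition walks (l : nat) (a b : int) : set (l.+1.-tuple int) :=
  [set alpha | [/\ is_walk alpha, alpha`_0 = a & alpha`_l = b]].
Arguments walks : clear implicits.

Definition is_standard (l : nat) (alpha : l.+1.-tuple int) : Prop :=
  forall i : 'I_l.+1, alpha`_l <= alpha`_i.

Definition std_walks (l : nat) (a b : int) : set (l.+1.-tuple int) :=
  [set alpha | walks l a b alpha /\ is_standard alpha].
Arguments std_walks : clear implicits.

Section Weights.
Variables (F : fieldType) (s : nat).
Implicit Types A B C D : 'M[F]_s.

(* Only the steps -1, 0, 1 occur in a walk. *)
Definition step A B C (x y : int) : 'M[F]_s :=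
  if y - x == -1 then A else if y - x == 0 then B else C.

Definition step_star A B C D (x y : int) : 'M[F]_s :=
  if (x == 0) && (y == 0) then D else step A B C x y.

(* The order of the factors matters: these are products of matrices. *)
Definition weight A B C (l : nat) (alpha : l.+1.-tuple int) : 'M[F]_s :=
  \prod_(i < l) step A B C alpha`_i alpha`_i.+1.

Definition weight_star A B C D (l : nat) (alpha : l.+1.-tuple int) : 'M[F]_s :=
  \prod_(i < l) step_star A B C D alpha`_i alpha`_i.+1.

Definition u A B C D (k n : nat) : 'M[F]_s :=
  \sum_(alpha \in std_walks n (k%:Z - 1) 0) weight_star A B C D alpha.

(* M_a for a = -1, 0, 1; the walks are grouped by length. *)
Definition M A B C (a : int) : 'M[fps F]_s :=
  mx_series (fun l => \sum_(alpha \in walks l a 0) weight A B C alpha).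

Definition Rn A B C D (a : nat -> F) (n : nat) : 'M[F]_s :=
  \sum_(k \in [set k : nat | (1 <= k)%N]) a k *: u A B C D k n.

Definition L A B C : set {fraction (fps F)} :=
  generated_subfield (ratfun F `|` frac_entries (M A B C 0)
    `|` frac_entries (M A B C 1) `|` frac_entries (M A B C (-1))).

End Weights.

(* The sums over finite supports above would be 0 by convention on an infinite
   support; the next facts show that this does not occur. *)
Lemma walk_dist l a b alpha i : walks l a b alpha -> (i <= l)%N ->
  `|alpha`_i - a| <= i%:Z.
Proof.
case=> walk <- _; elim: i => [|i IHi] il; first by rewrite subrr normr0.
have := IHi (ltnW il); have := walk (Ordinal il).
by rewrite !inE /= => /or3P[] /eqP; lia.
Qed.

Lemma finite_walks l a b : finite_set (walks l a b).
Proof.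
pose h (t : l.+1.-tuple 'I_l.*2.+1) : l.+1.-tuple int :=
  map_tuple (fun k : 'I_l.*2.+1 => a - l%:Z + k%:Z) t.
apply: (@sub_finite_set _ _ (h @` setT)); last first.
  exact/finite_image/finite_finset.
move=> alpha walk /=.
exists [tuple inord (absz (alpha`_i - a + l%:Z)) | i < l.+1] => //.
apply: eq_from_tnth => i; rewrite tnth_map tnth_mktuple (tnth_nth 0).
have il : (i <= l)%N by rewrite -ltnS.
move: (walk_dist walk il); move: (alpha`_i) => x xi.
by rewrite inordK; lia.
Qed.

Lemma u_eq0 (F : fieldType) (s : nat) (A B C D : 'M[F]_s) k n :
  (n.+1 < k)%N -> u A B C D k n = 0.
Proof.
move=> nk; rewrite /u fsbig1 // => alpha [walk _].
have := walk_dist walk (leqnn n); case: walk => _ _ ->; lia.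
Qed.

(* Main.v *)
From HB Require Import structures.
Require Import Defs.
From mathcomp Require Import all_boot all_order all_algebra.
From mathcomp Require Import all_classical.
From mathcomp Require Import zify.

Set Implicit Arguments.
Unset Strict Implicit.
Unset Printing Implicit Defensive.

Import Order.TTheory GRing.Theory Num.Theory.
Local Open Scope classical_set_scope.
Local Open Scope ring_scope.

(* Let G be the first-passage series from 1 to 0 and V_k the series of the
   u_(k+1)^(n) in n, so that the series of the theorem is \sum_k a_(k+1) V_k.
   Splitting off the first step shows that the families M_k, M_k M_0^-1 M_1,
   M_(k+1), V_k and M_k M_0^-1 V_0 (k >= 0) all satisfy, for k >= 1,
     X_k = z (A X_(k-1) + B X_k + C X_(k+1)),
   and a solution is determined by X_0.  Hence G = M_1 M_0^-1,
   M_(k+1) = G M_k, V_(k+1) = G V_k, and the first-step equation at 0 gives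
   V_0 = (1 - z (D + C G))^-1, all with entries in L.  With
   S(b) = \sum_k b_k V_k,
     S(b) = b_0 V_0 + G S(k |-> b_(k+1)),
     (1 - G) S(b) = b_0 V_0 + G S(k |-> b_(k+1) - b_k),
   so that one reduces first to b polynomial, then to a lower degree. *)

(** * Matrices over F[[z]] viewed as power series with matrix coefficients *)

Section SeriesMatrices.
Variables (F : fieldType) (s : nat).
Implicit Types (X Y T : 'M[fps F]_s) (V : nat -> 'M[fps F]_s).

Lemma coefs_sum (I : Type) (r : seq I) (f : I -> fps F) n :
  coefs (\sum_(i <- r) f i) n = \sum_(i <- r) coefs (f i) n.
Proof. exact: (big_morph (fun f => coefs f n)). Qed.

Definition mxcoef n X : 'M[F]_s := \matrix_(i, j) coefs (X i j) n.

Lemma mxcoefP X Y : (forall n, mxcoef n X = mxcoef n Y) -> X = Y.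
Proof.
move=> XY; apply/matrixP => i j; apply/fpsP => n.
by have /matrixP/(_ i j) := XY n; rewrite !mxE.
Qed.

Lemma mxcoef_series (c : nat -> 'M[F]_s) n : mxcoef n (mx_series c) = c n.
Proof. by apply/matrixP => i j; rewrite !mxE. Qed.

Lemma mxcoef0 n : mxcoef n 0 = 0.
Proof. by apply/matrixP => i j; rewrite !mxE. Qed.

Lemma mxcoefD n X Y : mxcoef n (X + Y) = mxcoef n X + mxcoef n Y.
Proof. by apply/matrixP => i j; rewrite !mxE. Qed.

Lemma mxcoefB n X Y : mxcoef n (X - Y) = mxcoef n X - mxcoef n Y.
Proof. by apply/matrixP => i j; rewrite !mxE. Qed.

Lemma mxcoef_scalar1 n : mxcoef n 1%:M = (n == 0%N)%:R%:M.
Proof.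
apply/matrixP => i j; rewrite !mxE.
by case: (i == j); rewrite ?mulr1n ?mulr0n.
Qed.

Lemma mxcoefM n X Y :
  mxcoef n (X *m Y) = \sum_(i < n.+1) mxcoef i X *m mxcoef (n - i) Y.
Proof.
apply/matrixP => i j; rewrite !mxE coefs_sum summxE exchange_big /=.
by apply: eq_bigr => m _; rewrite !mxE; apply: eq_bigr => k _; rewrite !mxE.
Qed.

Definition fpsC (c : F) : fps F := fps_of_poly c%:P.
Definition fpsX : fps F := fps_of_poly 'X.

Lemma fpsXM (f : fps F) n :
  coefs (fpsX * f) n = if n is m.+1 then coefs f m else 0.
Proof.
rewrite /= (bigID (fun i : 'I_n.+1 => i == 1%N :> nat)) /= [X in _ + X]big1.
  case: n => [|n]; first by rewrite big_mkcond big_ord1 addr0.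
  rewrite (big_pred1 (lift ord0 ord0 : 'I_n.+2)) => [|i].
    by rewrite coefX mul1r addr0 /= subSS subn0.
  by [].
by move=> i /negbTE ni; rewrite coefX ni mul0r.
Qed.

Lemma mxcoefX n X :
  mxcoef n (fpsX *: X) = if n is m.+1 then mxcoef m X else 0.
Proof.
by apply/matrixP => i j; rewrite mxE mxE fpsXM; case: n => *; rewrite !mxE.
Qed.

Lemma mxcoefC n (c : F) X : mxcoef n (fpsC c *: X) = c *: mxcoef n X.
Proof.
apply/matrixP => i j; rewrite !mxE /= big_ord_recl /= coefC /= subn0.
by rewrite big1 ?addr0 // => k _; rewrite coefC mul0r.
Qed.

Lemma mxcoef_map n (A : 'M[F]_s) X :
  mxcoef n (map_mx fpsC A *m X) = A *m mxcoef n X.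
Proof.
rewrite mxcoefM big_ord_recl /= subn0 big1 ?addr0.
  by congr (_ *m _); apply/matrixP => i j; rewrite !mxE /= coefC.
move=> k _; rewrite (_ : mxcoef _ _ = 0) ?mul0mx //.
by apply/matrixP => i j; rewrite !mxE /= coefC.
Qed.

(* The sum of the [V k]; meaningful when [V k] is divisible by z^k. *)
Definition mxsum V : 'M[fps F]_s :=
  mx_series (fun n => \sum_(k < n.+1) mxcoef n (V k)).

Definition summable V := forall k n, (n < k)%N -> mxcoef n (V k) = 0.

(** Terms with [k] beyond [n] contribute nothing, so coefficients of different indices can all be
    summed over one common range. *)
Lemma mxcoef_mxsum V n N : summable V -> (n < N)%N ->
  mxcoef n (mxsum V) = \sum_(k < N) mxcoef n (V k).
Proof.
move=> Vs nN; rewrite mxcoef_series.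
rewrite (big_ord_widen N (fun k => mxcoef n (V k))) //.
rewrite big_mkcond /=; apply: eq_bigr => k _.
by case: ltnP => // nk; rewrite Vs.
Qed.

Lemma mxsum_recl V : summable V -> mxsum V = V 0%N + mxsum (fun k => V k.+1).
Proof.
move=> Vs; apply: mxcoefP => n.
rewrite mxcoefD (mxcoef_mxsum (N := n.+2)) // big_ord_recl.
rewrite (mxcoef_mxsum (N := n.+1)) // => k m mk; apply: Vs; lia.
Qed.

Lemma mulmx_mxsum T V : summable V ->
  T *m mxsum V = mxsum (fun k => T *m V k).
Proof.
move=> Vs; apply: mxcoefP => n; rewrite mxcoefM mxcoef_series.
under [RHS]eq_bigr do rewrite mxcoefM.
rewrite exchange_big; apply: eq_bigr => i _ /=.
by rewrite -mulmx_sumr (mxcoef_mxsum (N := n.+1)) // ltnS leq_subr.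
Qed.

(** Orders in z add up under products, and [T] has order at least one. Repeated multiplication by
    such a [T] therefore yields a [summable] family. *)
Lemma mxcoef_shiftM T X k : mxcoef 0 T = 0 ->
  (forall n, (n < k)%N -> mxcoef n X = 0) ->
  forall n, (n < k.+1)%N -> mxcoef n (T *m X) = 0.
Proof.
move=> T0 X0 n nk; rewrite mxcoefM big_ord_recl T0 mul0mx add0r big1 // => i _.
by rewrite X0 ?mulmx0 //; have := ltn_ord i; rewrite lift0; lia.
Qed.

(* The inverse is the geometric series of [1 - X]. *)
Lemma unitmx_mxcoef0 X : mxcoef 0 X = 1%:M -> X \in unitmx.
Proof.
move=> X0; pose T := 1%:M - X; pose V k : 'M[fps F]_s := T ^+ k.
have T0 : mxcoef 0 T = 0 by rewrite mxcoefB X0 mxcoef_scalar1 subrr.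
have VS k : V k.+1 = T *m V k by rewrite /V exprS.
have Vs : summable V.
  by elim=> [//|k IHk]; rewrite VS; apply: mxcoef_shiftM => //; apply: IHk.
have sumV : mxsum V = 1%:M + T *m mxsum V.
  rewrite {1}mxsum_recl // mulmx_mxsum //; congr (_ + mxsum _).
  exact/funext.
(* Over a commutative ring a one-sided inverse of a square matrix is two-sided. *)
suff /mulmx1_unit[] : X *m mxsum V = 1%:M by [].
have -> : X = 1%:M - T by rewrite opprB addrC subrK.
by rewrite mulmxBl mul1mx {1}sumV addrK.
Qed.

(** The factor [fpsX] makes each coefficient of [V k.+1] depend only on coefficients of smaller
    index. Strong induction on that index, for all [k] at once because [V k.+2] occurs, kills the
    difference of two solutions. *)
Lemma recurrence_uniq (A B C : 'M[fps F]_s) V V' :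
    (forall k, V k.+1 = fpsX *: (A *m V k + B *m V k.+1 + C *m V k.+2)) ->
    (forall k, V' k.+1 = fpsX *: (A *m V' k + B *m V' k.+1 + C *m V' k.+2)) ->
  V 0%N = V' 0%N -> V = V'.
Proof.
move=> VE V'E V0; pose W k := V k - V' k.
have WE k : W k.+1 = fpsX *: (A *m W k + B *m W k.+1 + C *m W k.+2).
  rewrite /W {1}VE {1}V'E -scalerBr !mulmxBr; congr (_ *: _).
  by rewrite opprD addrACA; congr (_ + _); rewrite opprD addrACA.
suff W0 n k : mxcoef n (W k) = 0.
  apply/funext => k; apply/eqP; rewrite -subr_eq0; apply/eqP.
  by apply: mxcoefP => n; rewrite W0 mxcoef0.
elim/ltn_ind: n k => n IHn [|k]; first by rewrite /W V0 subrr mxcoef0.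
rewrite WE mxcoefX; case: n IHn => // n IHn.
have cM T m : mxcoef n (T *m W m) = 0.
  by rewrite mxcoefM big1 // => i _; rewrite IHn ?mulmx0 // ltnS leq_subr.
by rewrite !mxcoefD !cM !addr0.
Qed.

End SeriesMatrices.

(** * First-step decomposition of sums over walks ending at 0 *)

Section WalkSums.
Variables (F : fieldType) (s : nat).
Variables (st : int -> int -> 'M[F]_s) (Q : int -> Prop).

(** Taking [Q] always true gives all walks; taking it to be nonnegativity gives the standard walks
    to 0. Both cases are thus treated together. *)
Definition walks_in l a : set (l.+1.-tuple int) :=
  [set alpha | walks l a 0 alpha /\ forall i : 'I_l.+1, Q alpha`_i].

Arguments walks_in : clear implicits.

Definition walk_sum l a : 'M[F]_s :=
  \sum_(alpha \in walks_in l a) \prod_(i < l) st alpha`_i alpha`_i.+1.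

Lemma walks_in_cons l a x (beta : l.+1.-tuple int) :
  walks_in l.+1 a [tuple of x :: beta] =
  [/\ x = a, Q a, beta`_0 - a \in [:: -1; 0; 1] & walks_in l beta`_0 beta].
Proof.
apply/propext; split=> [[[walk /= xa bl] Qb]|[-> Qa ba [[walk _ bl] Qb]]].
  have Qa : Q a by have := Qb ord0; rewrite /= xa.
  split=> //; first by have := walk ord0; rewrite /= xa.
  split; last by move=> i; have := Qb (lift ord0 i).
  by split=> // i; have := walk (lift ord0 i).
split; last by move=> i; case: (unliftP ord0 i) => [j|] ->; [exact: Qb|].
by split=> // i; case: (unliftP ord0 i) => [j|] ->; [exact: walk|].
Qed.

Lemma finite_walks_in l a : finite_set (walks_in l a).
Proof. by apply: sub_finite_set (finite_walks l a 0) => alpha []. Qed.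

Lemma walk_sum_cons l a b :
  \sum_(alpha \in (fun beta => [tuple of a :: beta]) @` walks_in l b)
     \prod_(i < l.+1) st alpha`_i alpha`_i.+1 = st a b *m walk_sum l b.
Proof.
rewrite fsbig_image; last first.
  by move=> x y _ _ /(congr1 val) [] /val_inj.
have fin := finite_walks_in l b.
rewrite /walk_sum (fsbig_finite _ _ fin) (fsbig_finite _ _ fin) /= mulmx_sumr.
apply: eq_big_seq => beta; rewrite in_fset_set // inE => -[[_ <- _] _].
by rewrite big_ord_recl.
Qed.

(** The walks from [a] split according to their second position, [a - 1], [a] or [a + 1], and the
    weight of the first step factors out on the left. *)
Lemma walk_sumS l a : Q a ->
  walk_sum l.+1 a = st a (a - 1) *m walk_sum l (a - 1)
    + st a a *m walk_sum l a + st a (a + 1) *m walk_sum l (a + 1).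
Proof.
move=> Qa; pose h (beta : l.+1.-tuple int) := [tuple of a :: beta].
have fin b : finite_set (h @` walks_in l b).
  exact/finite_image/finite_walks_in.
(* The second entry of a walk in the image recovers [b]. *)
have dis b c : b != c -> h @` walks_in l b `&` h @` walks_in l c `<=` set0.
  move=> bc _ [[x [[_ xb _] _] <-] [y [[_ yc _] _]]].
  move=> /(congr1 val) [] /val_inj xy.
  by move/eqP: bc; apply; rewrite -xb -yc xy.
rewrite -!walk_sum_cons -fsbigU0 //; last by apply: dis; lia.
rewrite -fsbigU0 ?finite_setU //.
  apply: eq_fsbigl; apply/seteqP; split=> [|_ [[]|] [beta Wb <-]].
  - case/tupleP=> x beta; rewrite walks_in_cons => -[-> _].
    rewrite !inE => /or3P ba Wb; case: ba => /eqP ba;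
      [left; left|left; right|right]; exists beta => //;
      move: Wb; congr (walks_in _ _ _); lia.
  1-3: rewrite walks_in_cons; move: (Wb) => [[_ b0 _] _];
    rewrite b0; split=> //; rewrite !inE; lia.
by rewrite setIUl subUset; split; apply: dis; lia.
Qed.

(** The starting point is itself subject to [Q]. For standard walks this discards the step from 0 to
    -1. *)
Lemma walk_sum_out l a : ~ Q a -> walk_sum l a = 0.
Proof.
move=> Qa; apply: fsbig1 => alpha [[_ aE _] Q0].
by case: Qa; rewrite -aE; apply: (Q0 ord0).
Qed.

Lemma walk_sum0 : Q 0 -> walk_sum 0 0 = 1%:M.
Proof.
move=> Q0; rewrite /walk_sum (_ : walks_in 0 0 = [set [tuple 0]]).
  by rewrite fsbig_set1 big_ord0.
apply/seteqP; split=> [|_ ->].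
  by case/tupleP=> x t [[_ /= -> _] _]; rewrite [t]tuple0; apply/val_inj.
by split=> [|i]; [split=> // -[]|rewrite (ord1 i)].
Qed.

Lemma walk_sum0_neq0 a : a != 0 -> walk_sum 0 a = 0.
Proof.
move=> a0; apply: fsbig1 => alpha [[_ aE a0E] _].
by move: a0; rewrite -aE a0E eqxx.
Qed.

End WalkSums.

(** The shift preserves size and leading coefficient, so the top terms cancel. Only a strict drop is
    claimed, which is valid in every characteristic. *)
Lemma size_shift_sub (F : idomainType) (p : {poly F}) :
  p != 0 -> (size ((p \Po ('X + 1%:P)) - p)%R < size p)%N.
Proof.
move=> p0; have s2 : size ('X + 1%:P : {poly F}) = 2%N by rewrite size_XaddC.
have sp := size_comp_poly2 p s2.
have lp : lead_coef (p \Po ('X + 1%:P)) = lead_coef p.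
  by rewrite lead_coef_comp ?s2 // lead_coefXaddC expr1n mulr1.
rewrite -(ltn_predK (m := 0) (n := size p)) ?size_poly_gt0 // ltnS.
apply/leq_sizeP => j; rewrite leq_eqVlt coefB => /predU1P[<-|pj].
  by rewrite -{1}sp -!lead_coefE lp subrr.
by rewrite !nth_default ?subrr ?sp // (leq_trans (leqSpred _) pj).
Qed.

(** * Matrices with entries in a subfield containing the polynomials *)

Section SubfieldEntries.
Variables (F : fieldType) (S : divringClosed {fraction (fps F)}).
Hypothesis polyS : forall p : {poly F}, tofrac (fps_of_poly p) \in S.

Definition entries_in n (X : 'M[fps F]_n) := forall i j, tofrac (X i j) \in S.

Lemma entries_inD n (X Y : 'M[fps F]_n) :
  entries_in X -> entries_in Y -> entries_in (X + Y).
Proof.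
by move=> XS YS i j; rewrite mxE rmorphD rpredD //; [apply: XS|apply: YS].
Qed.

Lemma entries_inN n (X : 'M[fps F]_n) : entries_in X -> entries_in (- X).
Proof. by move=> XS i j; rewrite mxE rmorphN rpredN; apply: XS. Qed.

Lemma entries_inM n (X Y : 'M[fps F]_n) :
  entries_in X -> entries_in Y -> entries_in (X *m Y).
Proof.
move=> XS YS i j; rewrite mxE rmorph_sum rpred_sum // => k _.
by rewrite rmorphM rpredM //; [apply: XS|apply: YS].
Qed.

Lemma entries_inZ n f (X : 'M[fps F]_n) :
  tofrac f \in S -> entries_in X -> entries_in (f *: X).
Proof. by move=> fS XS i j; rewrite mxE rmorphM rpredM //; apply: XS. Qed.

Lemma entries_in1 n : entries_in (1%:M : 'M[fps F]_n).
Proof. by move=> i j; rewrite mxE rmorphMn rmorph1 rpredMn ?rpred1. Qed.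

Lemma entries_inC n (A : 'M[F]_n) : entries_in (map_mx (@fpsC F) A).
Proof. by move=> i j; rewrite mxE; apply: polyS. Qed.

Lemma det_in n (X : 'M[fps F]_n) : entries_in X -> tofrac (\det X) \in S.
Proof.
move=> XS; rewrite rmorph_sum rpred_sum // => t _.
rewrite rmorphM rmorph_sign rpredM ?rpred_sign // rmorph_prod rpred_prod //.
by move=> i _; apply: XS.
Qed.

Lemma entries_inV n (X : 'M[fps F]_n) :
  X \in unitmx -> entries_in X -> entries_in (invmx X).
Proof.
move=> XU XS; rewrite /invmx XU; apply: entries_inZ => [|i j].
  (* The determinant is a unit of F[[z]], so its inverse there maps to its inverse in the fraction
     field. *)
  by rewrite rmorphV // rpredV det_in.
rewrite mxE rmorphM rmorph_sign rpredM ?rpred_sign //.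
by apply: det_in => k l; rewrite !mxE; apply: XS.
Qed.

(** * Weighted sums of a geometric family of matrices *)

Section Series.
Variables (n : nat) (G : 'M[fps F]_n) (V : nat -> 'M[fps F]_n).
Hypotheses (G0 : mxcoef 0 G = 0) (GS : entries_in G).
Hypotheses (VE : forall k, V k.+1 = G *m V k) (V0S : entries_in (V 0%N)).

(** This is S(b) of the overview. *)
Definition lin_series (b : nat -> F) := mxsum (fun k => fpsC (b k) *: V k).

Lemma lin_series_summable b : summable (fun k => fpsC (b k) *: V k).
Proof.
move=> k m mk; rewrite mxcoefC (_ : mxcoef m (V k) = 0) ?scaler0 //.
elim: k m mk => // k IHk; rewrite VE; exact: mxcoef_shiftM.
Qed.

Lemma lin_seriesB b c :
  lin_series (fun k => b k - c k) = lin_series b - lin_series c.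
Proof.
apply: mxcoefP => m; rewrite mxcoefB !mxcoef_series -sumrB.
by apply: eq_bigr => k _; rewrite !mxcoefC scalerBl.
Qed.

Lemma lin_series_recl b :
  lin_series b = fpsC (b 0%N) *: V 0%N + G *m lin_series (fun k => b k.+1).
Proof.
rewrite {1}/lin_series mxsum_recl; last exact: lin_series_summable.
rewrite mulmx_mxsum; last exact: lin_series_summable.
congr (_ + mxsum _); apply/funext => k.
by rewrite VE -scalemxAr.
Qed.

Lemma lin_series_diff b :
  (1%:M - G) *m lin_series b =
  fpsC (b 0%N) *: V 0%N + G *m lin_series (fun k => b k.+1 - b k).
Proof.
by rewrite mulmxBl mul1mx lin_seriesB mulmxBr {1}lin_series_recl addrA.
Qed.

(** Induction on the size of [p]: the difference of [b] comes from a polynomial of smaller size, and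
    [1%:M - G] can be divided out because [G] has no constant term. *)
Lemma lin_series_poly_in b (p : {poly F}) :
  (forall k, b k = p.[k%:R]) -> entries_in (lin_series b).
Proof.
have [m] := ubnP (size p); elim: m => // m IHm in b p * => pm bE.
have [p0|p0] := eqVneq p 0.
  suff -> : lin_series b = 0 by move=> i j; rewrite mxE rmorph0 rpred0.
  apply: mxcoefP => k; rewrite mxcoef_series mxcoef0 big1 // => i _.
  by rewrite mxcoefC bE p0 horner0 scale0r.
have GU : 1%:M - G \in unitmx.
  by apply: unitmx_mxcoef0; rewrite mxcoefB G0 subr0 mxcoef_scalar1.
rewrite -(mulKmx GU (lin_series b)) lin_series_diff.
apply: entries_inM.
  apply: entries_inV => //.
  by apply: entries_inD; [exact: entries_in1|exact: entries_inN].
apply: entries_inD; first by apply: entries_inZ; [apply: polyS|].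
apply: entries_inM => //; apply: (IHm _ ((p \Po ('X + 1%:P)) - p)).
  exact: leq_trans (size_shift_sub p0) pm.
by move=> k; rewrite !bE !hornerE horner_comp !hornerE natr1.
Qed.

(** Each peeling of the first term lowers the threshold [N] by one and replaces p(X) by p(X + 1). *)
Lemma lin_series_eventually_poly_in b (p : {poly F}) N :
  (forall k, (N <= k)%N -> b k = p.[k%:R]) -> entries_in (lin_series b).
Proof.
elim: N b p => [|N IHN] b p bE.
  by apply: lin_series_poly_in => k; apply: bE.
rewrite lin_series_recl; apply: entries_inD;
  first by apply: entries_inZ; [apply: polyS|].
apply: entries_inM => //; apply: (IHN _ (p \Po ('X + 1%:P))) => k Nk.
by rewrite bE // horner_comp !hornerE natr1.
Qed.

End Series.
End SubfieldEntries.

(** * The series of walks and the first-passage matrix *)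

Section WalkSeries.
Variables (F : fieldType) (s : nat) (A B C D : 'M[F]_s).

Let Q0 (x : int) := 0 <= x.

(** This is V_k of the overview; with the shifted index, the walks start at [k]. *)
Definition std_series k : 'M[fps F]_s := mx_series (u A B C D k.+1).

Lemma M_walk_sum a :
  M A B C a = mx_series (fun l => walk_sum (step A B C) (fun=> True) l a).
Proof.
congr mx_series; apply/funext => l; apply: eq_fsbigl.
by apply/seteqP; split=> alpha // [].
Qed.

(** For a walk ending at 0, standard means nonnegative. *)
Lemma u_walk_sum k l :
  u A B C D k.+1 l = walk_sum (step_star A B C D) Q0 l k%:Z.
Proof.
rewrite /u (_ : k.+1%:Z - 1 = k%:Z); last by lia.
apply: eq_fsbigl; apply/seteqP; split=> alpha [W H]; split=> // i;
  by have := H i; case: W => _ _ ->.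
Qed.

Lemma stepN x : step A B C x (x - 1) = A.
Proof. by rewrite /step ifT //; lia. Qed.

Lemma step0 x : step A B C x x = B.
Proof. by rewrite /step ifF ?ifT //; lia. Qed.

Lemma stepP x : step A B C x (x + 1) = C.
Proof. by rewrite /step ifF ?ifF //; lia. Qed.

Lemma step_starE x y : x != 0 -> step_star A B C D x y = step A B C x y.
Proof. by rewrite /step_star => /negbTE->. Qed.

Let lift_mx (X : 'M[F]_s) := map_mx (@fpsC F) X.

Lemma M_recurrence k : M A B C k.+1%:Z = fpsX F *:
  (lift_mx A *m M A B C k%:Z + lift_mx B *m M A B C k.+1%:Z
     + lift_mx C *m M A B C k.+2%:Z).
Proof.
apply: mxcoefP => n; rewrite !M_walk_sum mxcoefX mxcoef_series.
case: n => [|n]; first by rewrite walk_sum0_neq0.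
rewrite !mxcoefD !mxcoef_map !mxcoef_series walk_sumS // stepN step0 stepP.
by congr (_ *m walk_sum _ _ _ _ + _ + _ *m walk_sum _ _ _ _); lia.
Qed.

Lemma std_recurrence k : std_series k.+1 = fpsX F *:
  (lift_mx A *m std_series k + lift_mx B *m std_series k.+1
     + lift_mx C *m std_series k.+2).
Proof.
apply: mxcoefP => n; rewrite mxcoefX mxcoef_series u_walk_sum.
case: n => [|n]; first by rewrite walk_sum0_neq0.
rewrite !mxcoefD !mxcoef_map !mxcoef_series !u_walk_sum walk_sumS //.
rewrite !step_starE // stepN step0 stepP.
by congr (_ *m walk_sum _ _ _ _ + _ + _ *m walk_sum _ _ _ _); lia.
Qed.

(** The summand [1%:M] is the walk of length 0. From 0, staying has weight [D], going up has weight
    [C], and going down is forbidden. *)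
Lemma std_recurrence0 : std_series 0 = 1%:M + fpsX F *:
  (lift_mx D *m std_series 0 + lift_mx C *m std_series 1).
Proof.
apply: mxcoefP => n; rewrite mxcoefD mxcoefX mxcoef_scalar1 mxcoef_series.
rewrite u_walk_sum; case: n => [|n]; first by rewrite walk_sum0 ?addr0.
rewrite (_ : (n.+1 == 0)%N%:R%:M = 0) ?add0r; last first.
  exact: (raddf0 (@scalar_mx F s)).
rewrite !mxcoefD !mxcoef_map !mxcoef_series !u_walk_sum walk_sumS //.
rewrite walk_sum_out // mulmx0 add0r {1}/step_star eqxx /=.
by rewrite /step_star /= /step /= add0r.
Qed.

Lemma M0_unit : M A B C 0 \in unitmx.
Proof.
by apply: unitmx_mxcoef0; rewrite M_walk_sum mxcoef_series walk_sum0.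
Qed.

(* The first-passage series from 1 to 0. *)
Definition passage := M A B C 1 *m invmx (M A B C 0).

Lemma passage_coef0 : mxcoef 0 passage = 0.
Proof.
rewrite mxcoefM big_ord1 M_walk_sum mxcoef_series walk_sum0_neq0 //.
by rewrite mul0mx.
Qed.

(** Right multiplication preserves the recurrence, so uniqueness first gives a ratio on the right,
    M_(k+1) = M_k N with N = M_0^-1 M_1. Induction moves it to the left: M_(k+2) = M_(k+1) N = G M_k
    N = G M_(k+1). *)
Lemma M_passage k : M A B C k.+1%:Z = passage *m M A B C k%:Z.
Proof.
have ME := M_recurrence; set M' := fun k : nat => M A B C k%:Z in ME *.
have M'E j : M' j.+1 = M' j *m (invmx (M' 0%N) *m M' 1%N).
  apply: (congr1 (fun V => V j) (x := fun j => M' j.+1)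
    (y := fun j => M' j *m _)).
  apply: (recurrence_uniq (A := lift_mx A) (B := lift_mx B) (C := lift_mx C)).
  - by move=> i; apply: ME.
  - by move=> i; rewrite {1}/M' ME -scalemxAl !mulmxDl !mulmxA.
  - by rewrite mulmxA mulmxV ?mul1mx //; apply: M0_unit.
elim: k => [|k IHk]; first by rewrite -mulmxA mulVmx ?mulmx1 // M0_unit.
rewrite [LHS](M'E k.+1) {1}/M' {1}IHk -mulmxA; congr (_ *m _).
exact/esym/M'E.
Qed.

(** Away from 0 the weights w and w* agree, so [std_series] solves the same recurrence as the M_k
    and inherits their left ratio. *)
Lemma std_passage k : std_series k.+1 = passage *m std_series k.
Proof.
have VE j : std_series j = M A B C j%:Z *m (invmx (M A B C 0) *m std_series 0).
  apply: (congr1 (fun V => V j) (x := std_series)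
    (y := fun j => M A B C j%:Z *m _)).
  apply: (recurrence_uniq (A := lift_mx A) (B := lift_mx B) (C := lift_mx C)).
  - exact: std_recurrence.
  - by move=> i; rewrite {1}M_recurrence -scalemxAl !mulmxDl !mulmxA.
  - by rewrite mulmxA mulmxV ?mul1mx // M0_unit.
by rewrite (VE k) (VE k.+1) M_passage mulmxA.
Qed.

Let kernel := 1%:M - fpsX F *: (lift_mx D + lift_mx C *m passage).

Lemma std_kernel_unit : kernel \in unitmx.
Proof.
by apply: unitmx_mxcoef0; rewrite mxcoefB mxcoefX subr0 mxcoef_scalar1.
Qed.

Lemma std_series0 : std_series 0 = invmx kernel.
Proof.
rewrite -[LHS](mulKmx std_kernel_unit) -[RHS]mulmx1; congr (_ *m _).
rewrite mulmxBl mul1mx -scalemxAl mulmxDl -mulmxA -std_passage.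
by rewrite {1}std_recurrence0 addrK.
Qed.

Lemma Rn_std_series a :
  mx_series (Rn A B C D a) = lin_series std_series (fun k => a k.+1).
Proof.
apply: mxcoefP => n; rewrite !mxcoef_series.
under [RHS]eq_bigr do rewrite mxcoefC mxcoef_series.
rewrite (fsbig_ord _ _ (fun k => a k.+1 *: u A B C D k.+1 n)).
rewrite -(fsbig_image `I_n.+1 S (fun k => a k *: u A B C D k n));
  last by move=> x y _ _ [].
(* Indices [k] above [n.+1] add nothing, since 0 is then out of reach in [n] steps from [k - 1]. *)
apply/esym/fsbig_widen => [_ [k _ <-] //|k [k0 kn]] /=.
rewrite u_eq0 ?scaler0 //; case: k k0 kn => // k _ kn; rewrite ltnNge ltnS.
by apply/negP => kn'; apply: kn; exists k => //=; rewrite ltnS.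
Qed.

End WalkSeries.

Theorem theorem5p8 (F : fieldType) (s : nat) (A B C D : 'M[F]_s)
  (a : nat -> F)
  (ha : exists (p : {poly F}) (N : nat),
     forall j : nat, (1 <= j)%N -> (N <= j)%N -> a j = p.[j%:R]) :
  forall i j : 'I_s,
    tofrac (mx_series (Rn A B C D a) i j) \in L A B C.
Proof.
case: ha => p [N aE] i j; rewrite inE => S [S_field SG].
(* [L] is an intersection, so the claim is checked in an arbitrary subfield [S] containing the
   generators. *)
pose divS := GRing.isDivringClosed.Build _ (mem S) S_field.
pose S' : divringClosed {fraction (fps F)} := HB.pack (mem S : _ -> bool) divS.
have inS x : S x = (x \in S') :> Prop by rewrite propeqE; split; rewrite inE.
have polyS (q : {poly F}) : tofrac (fps_of_poly q) \in S'.
  rewrite -inS; apply: SG; left; left; left; exists q, 1; split.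
    exact: oner_neq0.
  rewrite (_ : fps_of_poly 1 = 1) ?rmorph1 ?divr1 //.
  by apply/fpsP => k /=; rewrite coef1.
have M0S : entries_in S' (M A B C 0).
  by move=> k l; rewrite -inS; apply: SG; left; left; right; exists k, l.
have M1S : entries_in S' (M A B C 1).
  by move=> k l; rewrite -inS; apply: SG; left; right; exists k, l.
have GS : entries_in S' (passage A B C).
  by apply: entries_inM => //; apply: entries_inV => //; apply: M0_unit.
rewrite inS Rn_std_series.
(* The coefficient at index [k] is [a k.+1], hence the shift of [p]; the threshold [N] still
   works. *)
apply: (@lin_series_eventually_poly_in _ S' polyS _ _ _ (passage_coef0 A B C)
  GS (@std_passage _ _ A B C D) _ _ (p \Po ('X + 1%:P)) N); last first.
  by move=> k Nk; rewrite aE ?horner_comp ?hornerE ?natr1 //; lia.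
rewrite std_series0; apply: entries_inV; first exact: std_kernel_unit.
apply: entries_inD; first exact: entries_in1.
apply/entries_inN/entries_inZ; first exact: polyS.
apply: entries_inD; first exact: entries_inC.
by apply: entries_inM => //; apply: entries_inC.
Qed.
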